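(* Let $n = 2k+1 \geq 3$ be odd. There exists a schedule for an asynchronous single round-robin tournament with $n$ teams that has guaranteed rest time $k-1$, games-played difference index $1$, and rest difference index $1$.
   Context: An asynchronous single round-robin tournament with $n$ teams is one in which every pair of distinct teams plays exactly once and no two games are simultaneous; a schedule is a linear ordering of the $\binom{n}{2}$ games. The guaranteed rest time of a schedule is the maximum integer $b$ such that any two games involving the same team are separated by at least $b$ games not involving that team. The games-played difference index is the minimum integer $p$ such that at every point in the schedule, the numbers of games played so far by any two teams differ by at most $p$. The rest difference index is the minimum integer $d$ such that for every game, if one of its teams has not played in $i_1$ consecutive games since its last game and the other in $i_2$ consecutive games since its last game, then $|i_1-i_2|\le d$; for a team playing its first game, all teams are deemed to have played in an imaginary game placed immediately before the first game of the schedule. *)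

(* Defs.v *)
From mathcomp Require Import all_boot all_order all_algebra.
Set Implicit Arguments.
Unset Strict Implicit.
Unset Printing Implicit Defensive.

Section Tournament.

Variable n : nat.

(* The teams are the elements of 'I_n; a game is the pair of teams playing it. *)
Definition games : {set {set 'I_n}} := [set g : {set 'I_n} | #|g| == 2].

Definition is_schedule (s : seq {set 'I_n}) : Prop := uniq s /\ s =i games.

Definition separated_by (s : seq {set 'I_n}) (b : nat) : Prop :=
  forall (t : 'I_n) (i j : nat), i < j < size s ->
    t \in nth set0 s i -> t \in nth set0 s j ->
    b <= count (fun g : {set 'I_n} => t \notin g) (drop i.+1 (take j s)).

Definition guaranteed_rest_time (s : seq {set 'I_n}) (b : nat) : Prop :=
  separated_by s b /\ (forall b' : nat, separated_by s b' -> b' <= b).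

Definition games_played (s : seq {set 'I_n}) (m : nat) (t : 'I_n) : nat :=
  count (fun g : {set 'I_n} => t \in g) (take m s).

Definition games_played_within (s : seq {set 'I_n}) (p : nat) : Prop :=
  forall (m : nat) (t1 t2 : 'I_n), m <= size s ->
    `|games_played s m t1 - games_played s m t2|%N <= p.

Definition games_played_difference_index (s : seq {set 'I_n}) (p : nat) : Prop :=
  games_played_within s p /\ (forall p' : nat, games_played_within s p' -> p <= p').

(* The games before position j (counted from 0) are scanned backwards from j
   to the latest one involving t. If t has not played yet, [find] returns the
   size j of the scanned list, which is the rest of t since the imaginary game
   placed just before position 0. *)
Definition rest (s : seq {set 'I_n}) (j : nat) (t : 'I_n) : nat :=
  find (fun g : {set 'I_n} => t \in g) (rev (take j s)).

Definition rest_within (s : seq {set 'I_n}) (d : nat) : Prop :=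
  forall (j : nat) (t1 t2 : 'I_n), j < size s ->
    t1 \in nth set0 s j -> t2 \in nth set0 s j ->
    `|rest s j t1 - rest s j t2|%N <= d.

Definition rest_difference_index (s : seq {set 'I_n}) (d : nat) : Prop :=
  rest_within s d /\ (forall d' : nat, rest_within s d' -> d <= d').

End Tournament.

(* Main.v *)
(** Arrange the games in [2k + 1] rounds of [k] games each, team [r] having the
    bye in round [r]. In the rounds before its bye a team plays in a slot that
    moves from one round to the next by 0 or 1, reaching the last slot just
    before the bye; after the bye it restarts from slot 0 and moves again by
    0 or 1. Consecutive games of a team are thus [k] or [k + 1] apart, which
    bounds both the rest times and their differences. In round [r], the teams
    that already had their bye, and are one game behind, all play in slots at
    most [(r - 1) / 2], and the others in slots at least [r / 2] (both rounded
    down); hence the games-played index.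

    Two teams [x, y < 2k] meet in round [x + y + 1] if [x + y < 2k] and in
    round [x + y - 2k] otherwise; team [2k] meets [x] in the round where [x]
    would have met itself. *)

Require Import Defs.
From mathcomp Require Import all_boot all_order all_algebra.
From mathcomp Require Import zify.

Set Implicit Arguments.
Unset Strict Implicit.
Unset Printing Implicit Defensive.

(** * Arithmetic of rounds and slots *)

Section Slots.

Variable k : nat.
Hypothesis k_gt0 : 0 < k.

(* Meaningful only for [r != t], since team [t] does not play in round [t]. *)
Definition slot (t r : nat) : nat :=
  if t == 2 * k then r %/ 2
  else if t < r then minn t (r - 1 - t)
  else maxn (t - k) (r + k - t).

Definition plays (t r i : nat) : bool := (r != t) && (i == slot t r).

Definition plays_at (t j : nat) : bool := plays t (j %/ k) (j %% k).

Lemma plays_atE t r i : i < k -> plays_at t (r * k + i) = plays t r i.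
Proof.
move=> ik; rewrite /plays_at divnMDl // modnMDl.
by rewrite divn_small // modn_small // addn0.
Qed.

Lemma slot_lt t r : t <= 2 * k -> r <= 2 * k -> r != t -> slot t r < k.
Proof. rewrite /slot; case: ifP; [lia | case: ifP; lia]. Qed.

Lemma slot_step t r : t <= 2 * k -> r < 2 * k -> r != t -> r.+1 != t ->
  slot t r <= slot t r.+1 <= (slot t r).+1.
Proof.
rewrite /slot; case: ifP; first by lia.
by case: ifP; case: ifP; lia.
Qed.

Lemma slot_before_bye t : 0 < t <= 2 * k -> slot t t.-1 = k.-1.
Proof. rewrite /slot; case: ifP; [lia | case: ifP; lia]. Qed.

Lemma slot_after_bye t : t < 2 * k -> slot t t.+1 = 0.
Proof. rewrite /slot; case: ifP; [lia | case: ifP; lia]. Qed.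

Lemma slot_before_half t r : t < r -> r <= 2 * k -> slot t r <= (r - 1) %/ 2.
Proof. rewrite /slot; case: ifP; [lia | case: ifP; lia]. Qed.

Lemma slot_after_half t r : r < t -> t <= 2 * k -> r %/ 2 <= slot t r.
Proof. rewrite /slot; case: ifP; [lia | case: ifP; lia]. Qed.

(** Teams below [2 * k] that meet in round [r] have sum [r - 1] or [r + 2 * k]. Their common slot is
    the smaller team in the first case, the larger team minus [k] in the second. The self-paired
    team sits in slot [r %/ 2], where team [2 * k] joins it. *)
Lemma plays_pair x y : x < y <= 2 * k ->
  exists r i, [/\ r <= 2 * k, i < k &
    forall t, t <= 2 * k -> plays t r i = (t == x) || (t == y)].
Proof.
move=> /andP[xy yk]; have [ey|ny] := eqVneq y (2 * k).
  have [xk|kx] := ltnP x k.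
    exists (2 * x + 1), x; split; [lia|lia|move=> t tk].
    by rewrite /plays /slot; case: ifP; [|case: ifP]; lia.
  exists (2 * (x - k)), (x - k); split; [lia|lia|move=> t tk].
  by rewrite /plays /slot; case: ifP; [|case: ifP]; lia.
have [sk|ks] := ltnP (x + y) (2 * k).
  exists (x + y + 1), x; split; [lia|lia|move=> t tk].
  by rewrite /plays /slot; case: ifP; [|case: ifP]; lia.
exists (x + y - 2 * k), (y - k); split; [lia|lia|move=> t tk].
by rewrite /plays /slot; case: ifP; [|case: ifP]; lia.
Qed.

(** Between consecutive rounds the slot never decreases; otherwise a whole round lies between the
    two games. *)
Lemma plays_at_gap t i j : t <= 2 * k -> j < (2 * k + 1) * k -> i < j ->
  plays_at t i -> plays_at t j -> i + k <= j.
Proof.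
move=> tk jn ij /andP[rt /eqP ei] /andP[rt' /eqP ej].
have r'k : j %/ k < 2 * k + 1 by rewrite ltn_divLR.
have [rr|rr] := leqP (i %/ k).+2 (j %/ k).
  have := leq_mul rr (leqnn k); have := ltn_pmod i k_gt0.
  have := divn_eq i k; have := divn_eq j k; lia.
have := leq_div2r k (ltnW ij); rewrite leq_eqVlt => /orP[/eqP err|ltr].
  have := divn_eq i k; have := divn_eq j k; rewrite ei ej err; lia.
have er : j %/ k = (i %/ k).+1 by lia.
rewrite er in rt' r'k ej.
have /andP[sl _] : slot t (i %/ k) <= slot t (i %/ k).+1 <= (slot t (i %/ k)).+1.
  by apply: slot_step => //; lia.
have := divn_eq i k; have := divn_eq j k; rewrite er ei ej; lia.
Qed.

Lemma plays_at_prev t j : t <= 2 * k -> k < j < (2 * k + 1) * k ->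
  plays_at t j -> plays_at t (j - k) \/ plays_at t (j - k.+1).
Proof.
move=> tk /andP[kj jn] /andP[rt /eqP ej].
have rk : j %/ k < 2 * k + 1 by rewrite ltn_divLR.
have r0 : 0 < j %/ k by rewrite divn_gt0 // ltnW.
have dj := divn_eq j k; rewrite ej in dj.
have ik := slot_lt tk (_ : j %/ k <= 2 * k) rt.
move: (j %/ k) rt rk r0 dj ik {ej} => [//|r] rt rk _ dj ik.
have {}ik : slot t r.+1 < k by apply: ik; lia.
have [ert|nrt] := eqVneq t r.
  have tk2 : t < 2 * k by lia.
  (* Across the bye, the last slot of round [t - 1] and slot 0 of round [t + 1] are [k + 1] apart. A
     bye in round 0 would give [j = k], which is excluded. *)
  rewrite ert slot_after_bye in dj; last by lia.
  case: r {rt ik} rk ert dj => [|r] rk ert dj; first by lia.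
  right; have -> : j - k.+1 = r * k + k.-1 by lia.
  rewrite plays_atE ?/plays; last by lia.
  have := @slot_before_bye t; rewrite ert /= => ->; lia.
have /andP[s1 s2] : slot t r <= slot t r.+1 <= (slot t r).+1.
  by apply: slot_step; lia.
have sk : slot t r < k by lia.
have [es|ns] := eqVneq (slot t r.+1) (slot t r).
  left; have -> : j - k = r * k + slot t r by lia.
  by rewrite plays_atE // /plays eqxx andbT eq_sym.
right; have -> : j - k.+1 = r * k + slot t r by lia.
by rewrite plays_atE // /plays eqxx andbT eq_sym.
Qed.

Lemma count_plays_at t q i : t <= 2 * k -> q <= 2 * k -> i <= k ->
  count (plays_at t) (iota 0 (q * k + i))
    = q - (t < q) + ((q != t) && (slot t q < i)).
Proof.
move=> tk; elim: q i => [|q IHq] i qk.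
  elim: i => [|i IHi] ik; first by rewrite /=; lia.
  rewrite addnS -addn1 iotaD count_cat IHi ?(ltnW ik) //= add0n.
  rewrite plays_atE // /plays; lia.
have q0 : count (plays_at t) (iota 0 (q.+1 * k)) = q.+1 - (t < q.+1).
  rewrite mulSn addnC IHq ?leqnn ?(ltnW qk) //.
  by have := @slot_lt t q tk (ltnW qk); lia.
elim: i => [|i IHi] ik; first by rewrite addn0 q0; lia.
rewrite addnS -addn1 iotaD count_cat IHi ?(ltnW ik) //= add0n.
rewrite plays_atE // /plays; lia.
Qed.

Lemma count_plays_at_bounds q i : q <= 2 * k -> i <= k ->
  exists c, forall t, t <= 2 * k ->
    c <= count (plays_at t) (iota 0 (q * k + i)) <= c.+1.
Proof.
move=> qk ik.
(* Within the first [q %/ 2] slots of round [q], no team with its bye ahead has played, so no count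
   exceeds [q]. Beyond them, every team past its bye has caught up, so no count is below [q]. *)
have [iq|qi] := leqP i (q %/ 2); [exists q.-1|exists q] => t tk;
  rewrite count_plays_at //; have := @slot_before_half t q;
  have := @slot_after_half t q; lia.
Qed.

End Slots.

(** * The schedule as a list of games *)

Section Schedule.

Variables n k : nat.
Hypothesis n_eq : n = 2 * k + 1.
Hypothesis k_gt0 : 0 < k.

Definition game_at (j : nat) : {set 'I_n} := [set t : 'I_n | plays_at k t j].

Definition slot_schedule : seq {set 'I_n} := mkseq game_at (n * k).

Lemma team_le (t : 'I_n) : t <= 2 * k.
Proof. by have := ltn_ord t; lia. Qed.

Lemma mem_nth_slot_schedule (t : 'I_n) j : j < n * k ->
  (t \in nth set0 slot_schedule j) = plays_at k t j.
Proof. by move=> jn; rewrite nth_mkseq // inE. Qed.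

Lemma slot_schedule_is_schedule : is_schedule slot_schedule.
Proof.
(* Covering all pairs suffices: the list has exactly as many entries as there are pairs, so nothing
   repeats and nothing else occurs. *)
have sub : {subset enum (games n) <= slot_schedule}.
  move=> g; rewrite mem_enum inE => /cards2P[x [y [xy ->]]].
  wlog ltxy : x y xy / x < y => [H|].
    have [|lexy|/val_inj exy] := ltngtP x y; first exact: H.
      by rewrite setUC; apply: H; rewrite // eq_sym.
    by rewrite exy eqxx in xy.
  have [|r [i [rk ik rP]]] := @plays_pair k k_gt0 x y.
    by rewrite ltxy team_le.
  apply/mapP; exists (r * k + i).
    rewrite mem_iota add0n /=; have := leq_mul rk (leqnn k); lia.
  by apply/setP=> t; rewrite !inE plays_atE // rP ?team_le.
have sz : size slot_schedule <= size (enum (games n)).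
  rewrite size_mkseq -cardE card_draws card_ord bin2 n_eq addn1.
  by rewrite mul2n -doubleMr doubleK.
split; first exact: leq_size_uniq (enum_uniq _) sub sz.
by move=> g; have [_ <-] := uniq_min_size (enum_uniq _) sub sz; rewrite mem_enum.
Qed.

Lemma slot_schedule_gap (t : 'I_n) i j : i < j < n * k ->
  t \in nth set0 slot_schedule i -> t \in nth set0 slot_schedule j -> i + k <= j.
Proof.
move=> /andP[ij jn]; rewrite !mem_nth_slot_schedule ?(ltn_trans ij) //.
by apply: plays_at_gap; rewrite -?n_eq // team_le.
Qed.

(** Slot [r %/ 2] is 0 in rounds 0 and 1. These two games witness that the three values are
    sharp. *)
Lemma special_team_opening (j : nat) (t : 'I_n) : t = 2 * k :> nat ->
  (j == 0) || (j == k) -> t \in nth set0 slot_schedule j.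
Proof.
move=> tk jk; have nk : k < n * k by nia.
rewrite mem_nth_slot_schedule; last by lia.
have -> : j = (j == k) * k + 0 by lia.
by rewrite plays_atE // /plays /slot tk eqxx; lia.
Qed.

(** * Guaranteed rest time *)

Lemma slot_schedule_separated : separated_by slot_schedule (k - 1).
Proof.
move=> t i j; rewrite size_mkseq => ijn ti tj.
have kij := slot_schedule_gap ijn ti tj.
have /andP[ij jn] := ijn.
rewrite -(cat_take_drop (k - 1) (drop _ _)) count_cat.
apply: leq_trans (leq_addr _ _).
set w := take _ _.
have szw : size w = k - 1.
  by rewrite size_takel // size_drop size_takel ?size_mkseq; lia.
(* The [k - 1] games right after position [i] are closer to [i] than [t] can play again. *)
suff : all (fun g : {set 'I_n} => t \notin g) w.
  by rewrite all_count szw => /eqP->.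
apply/(all_nthP set0) => l; rewrite szw => lk.
rewrite nth_take // nth_drop nth_take; last by lia.
apply/negP=> tl; have := slot_schedule_gap _ ti tl; lia.
Qed.

Lemma slot_schedule_rest_time : guaranteed_rest_time slot_schedule (k - 1).
Proof.
split=> [|b sep]; first exact: slot_schedule_separated.
have kn : 2 * k < n by lia.
pose L := Ordinal kn.
have nk : k < n * k by nia.
have := sep L 0 k.
rewrite size_mkseq k_gt0 nk !special_team_opening ?eqxx ?orbT //.
move=> /(_ isT isT isT)/leq_trans; apply.
apply: leq_trans (count_size _ _) _.
by rewrite size_drop size_takel ?size_mkseq ?(ltnW nk).
Qed.

(** * Games-played difference *)

Lemma games_playedE m (t : 'I_n) : m <= n * k ->
  games_played slot_schedule m t = count (plays_at k t) (iota 0 m).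
Proof.
move=> mn; rewrite /games_played -map_take take_iota (minn_idPl mn) count_map.
by apply: eq_count => j /=; rewrite inE.
Qed.

Lemma slot_schedule_games_played :
  games_played_difference_index slot_schedule 1.
Proof.
split=> [m t1 t2|p].
  rewrite size_mkseq => mn; rewrite !games_playedE //.
  have [q [i [qk ik ->]]] : exists q i, [/\ q <= 2 * k, i <= k & m = q * k + i].
    have [lm|gm] := ltnP m (n * k).
      exists (m %/ k), (m %% k); rewrite -divn_eq (ltnW (ltn_pmod _ _)) //.
      by split=> //; have := ltn_divLR m n k_gt0; lia.
    (* The end of the schedule is read as round [2 * k] with all its slots played. *)
    by exists (2 * k), k; split=> //; nia.
  have [c cP] := count_plays_at_bounds k_gt0 qk ik.
  by have := cP _ (team_le t1); have := cP _ (team_le t2); lia.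
have kn : 2 * k < n by lia.
have n0 : 0 < n by lia.
have nk : 0 < n * k by nia.
(* After one game, team [2 * k] has played and team 0, on its bye, has not. *)
move=> /(_ 1 (Ordinal kn) (Ordinal n0)).
rewrite size_mkseq !games_playedE //= !addn0.
move=> /(_ nk).
have -> : plays_at k (2 * k) 0.
  have := @special_team_opening 0 (Ordinal kn) erefl erefl.
  by rewrite mem_nth_slot_schedule.
by rewrite /plays_at /plays div0n.
Qed.

(** * Rest difference *)

Lemma leq_rest (s : seq {set 'I_n}) j (t : 'I_n) d : d <= j <= size s ->
  (forall i, j - d <= i < j -> t \notin nth set0 s i) -> d <= rest s j t.
Proof.
move=> /andP[dj js] H; rewrite leqNgt; apply/negP => ltd.
have szr : size (rev (take j s)) = j by rewrite size_rev size_takel.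
have hf : has (fun g : {set 'I_n} => t \in g) (rev (take j s)).
  by rewrite has_find szr; apply: leq_trans ltd dj.
have := nth_find set0 hf; rewrite -/(rest s j t) nth_rev size_takel //; last by lia.
rewrite nth_take; last by lia.
by apply/negP/H; lia.
Qed.

Lemma rest_leq (s : seq {set 'I_n}) j (t : 'I_n) d : d < j <= size s ->
  t \in nth set0 s (j - d.+1) -> rest s j t <= d.
Proof.
move=> /andP[dj js] td; rewrite leqNgt; apply/negP => /(before_find set0).
by rewrite nth_rev size_takel // nth_take ?td //; lia.
Qed.

Lemma slot_schedule_rest_bounds j (t : 'I_n) : k <= j < n * k ->
  t \in nth set0 slot_schedule j -> k - 1 <= rest slot_schedule j t <= k.
Proof.
move=> /andP[kj jn] tj; apply/andP; split.
  apply: leq_rest => [|i ij]; first by rewrite size_mkseq; lia.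
  apply/negP=> ti; have := slot_schedule_gap _ ti tj; lia.
(* At position [k] there may be no earlier game of [t]; [rest] is still at most the number of
   preceding games. *)
have [ekj|nkj] := eqVneq k j.
  by rewrite ekj /rest (leq_trans (find_size _ _)) // size_rev size_takel //
    size_mkseq ltnW.
have kj' : k < j < (2 * k + 1) * k by rewrite -n_eq; lia.
rewrite mem_nth_slot_schedule // in tj.
have [tp|tp] := plays_at_prev k_gt0 (team_le t) kj' tj.
  have : rest slot_schedule j t <= k.-1; last by lia.
  apply: rest_leq; first by rewrite size_mkseq; lia.
  by rewrite prednK // mem_nth_slot_schedule //; lia.
apply: rest_leq; first by rewrite size_mkseq; lia.
by rewrite mem_nth_slot_schedule //; lia.
Qed.

(** By the gap of [k], such a game is the first one of [t], so the rest runs back to the imaginary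
    game. *)
Lemma rest_opening j (t : 'I_n) : j < k -> t \in nth set0 slot_schedule j ->
  rest slot_schedule j t = j.
Proof.
move=> jk tj; have nk : k < n * k by nia.
apply/eqP; rewrite eqn_leq; apply/andP; split.
  by rewrite /rest (leq_trans (find_size _ _)) // size_rev size_takel //
    size_mkseq; lia.
apply: leq_rest => [|i ij]; first by rewrite size_mkseq; lia.
apply/negP=> ti; have := slot_schedule_gap _ ti tj; lia.
Qed.

Lemma slot_schedule_rest_difference : rest_difference_index slot_schedule 1.
Proof.
split=> [j t1 t2|d].
  rewrite size_mkseq => jn tj1 tj2; have [jk|kj] := ltnP j k.
    by rewrite !rest_opening //; lia.
  have kjn : k <= j < n * k by rewrite kj.
  have := slot_schedule_rest_bounds kjn tj1.
  by have := slot_schedule_rest_bounds kjn tj2; lia.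
have kn : 2 * k < n by lia.
have n0 : 0 < n by lia.
have nk : k < n * k by nia.
pose L := Ordinal kn; pose Z := Ordinal n0.
(* The game at position [k] pairs team 0, idle throughout round 0, with team [2 * k], which played
   at position 0. *)
have Zk : Z \in nth set0 slot_schedule k.
  rewrite mem_nth_slot_schedule // -[X in plays_at _ _ X]addn0 -[X in X + 0]mul1n.
  by rewrite plays_atE // /plays /slot /=; case: ifP; lia.
have Lk : L \in nth set0 slot_schedule k by rewrite special_team_opening // eqxx orbT.
have rZ : k <= rest slot_schedule k Z.
  apply: leq_rest => [|i]; first by rewrite leqnn size_mkseq ltnW.
  rewrite subnn /= => ik; rewrite mem_nth_slot_schedule ?(ltn_trans ik) //.
  by rewrite /plays_at /plays divn_small.
have rL : rest slot_schedule k L <= k.-1.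
  apply: rest_leq; first by rewrite size_mkseq; lia.
  by rewrite prednK // subnn special_team_opening.
move=> /(_ k Z L); rewrite size_mkseq => /(_ nk Zk Lk); lia.
Qed.

End Schedule.

Theorem theorem4p4 (n k : nat) (hn : n = 2 * k + 1) (hn3 : 3 <= n) :
  exists s : seq {set 'I_n},
    [/\ is_schedule s,
        guaranteed_rest_time s (k - 1),
        games_played_difference_index s 1
      & rest_difference_index s 1].
Proof.
have k_gt0 : 0 < k by lia.
exists (slot_schedule n k); split.
- exact: slot_schedule_is_schedule.
- exact: slot_schedule_rest_time.
- exact: slot_schedule_games_played.
- exact: slot_schedule_rest_difference.
Qed.
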